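(* Suppose the relaxed heavy traffic condition and the relaxed complete resource pooling condition hold. Then: (i) the optimal solution $(v^*,u^* )$ of the dual LP is unique; (ii) $u^*_k>0$ for all $k\in\mathcal{K}$ and $v^*_i>0$ for all $i\in\mathcal{I}$.
   Context: Job classes $\mathcal{I}=\{1,\ldots,I\}$, servers $\mathcal{K}=\{1,\ldots,K\}$, and a set $\mathcal{J}\subset\mathcal{I}\times\mathcal{K}$ of activities ($(i,k)\in\mathcal{J}$ means server $k$ can process class $i$). $\mathcal{I}(k)=\{i:(i,k)\in\mathcal{J}\}$, $\mathcal{K}(i)=\{k:(i,k)\in\mathcal{J}\}$. Arrival rates $\lambda_i>0$ ($i\in\mathcal{I}$) and service rates $\mu_{ik}>0$ ($(i,k)\in\mathcal{J}$) are given. LP (static allocation problem): minimize $\rho$ over $x=(x_{ik})_{(i,k)\in\mathcal{J}}\ge 0$, $\rho\ge0$, subject to $\sum_{k\in\mathcal{K}(i)}\mu_{ik}x_{ik}=\lambda_i$ for all $i$, and $\sum_{i\in\mathcal{I}(k)}x_{ik}\le\rho$ for all $k$. Dual LP: maximize $\sum_i\lambda_iv_i$ over $v\in\mathbb{R}^I$, $u\in\mathbb{R}^K$, $u\ge0$, subject to $\mu_{ik}v_i\le u_k$ for all $(i,k)\in\mathcal{J}$ and $\sum_ku_k\le1$. Relaxed heavy traffic condition: the LP has an optimal solution $(x^*,\rho^* )$ (not necessarily unique) with $\rho^*=1$ and $\sum_{i\in\mathcal{I}(k)}x^*_{ik}=1$ for every $k\in\mathcal{K}$. Activity $(i,k)$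 is a basic activity associated with such an $x^*$ if $x^*_{ik}>0$. Servers $k,k'$ communicate directly if for some such $x^*$ and some class $i$ both $(i,k)$ and $(i,k')$ are basic activities associated with $x^*$; servers $k,k'$ communicate if there is a sequence of servers $k=k_1,\ldots,k_\omega=k'$ with $k_\alpha$ communicating directly with $k_{\alpha+1}$ for each $\alpha$. Relaxed complete resource pooling condition: such an optimal solution $x^*$ exists and all servers communicate (different links may use different optimal $x^*$). *)

(* Defs.v *)
From mathcomp Require Export all_boot all_order all_algebra.
From mathcomp Require Export reals.

Set Implicit Arguments.
Unset Strict Implicit.
Unset Printing Implicit Defensive.

Import Order.TTheory GRing.Theory Num.Theory.
Local Open Scope ring_scope.

(* Families indexed by the set J of activities are encoded as full matrices:
   every condition below is restricted to J, and the entries of mu and x at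
   pairs outside J are ignored. *)

Definition primal_feasible (R : realType) (nI nK : nat)
    (J : {set 'I_nI * 'I_nK}) (lambda : 'rV[R]_nI) (mu : 'M[R]_(nI, nK))
    (x : 'M[R]_(nI, nK)) (rho : R) : Prop :=
  [/\ forall i k, (i, k) \in J -> 0 <= x i k,
      0 <= rho,
      forall i, \sum_(k < nK | (i, k) \in J) mu i k * x i k = lambda 0 i
    & forall k, \sum_(i < nI | (i, k) \in J) x i k <= rho].

Definition primal_optimal (R : realType) (nI nK : nat)
    (J : {set 'I_nI * 'I_nK}) (lambda : 'rV[R]_nI) (mu : 'M[R]_(nI, nK))
    (x : 'M[R]_(nI, nK)) (rho : R) : Prop :=
  primal_feasible J lambda mu x rho /\
  forall x' rho', primal_feasible J lambda mu x' rho' -> rho <= rho'.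

Definition dual_feasible (R : realType) (nI nK : nat)
    (J : {set 'I_nI * 'I_nK}) (mu : 'M[R]_(nI, nK))
    (v : 'rV[R]_nI) (u : 'rV[R]_nK) : Prop :=
  [/\ forall k, 0 <= u 0 k,
      forall i k, (i, k) \in J -> mu i k * v 0 i <= u 0 k
    & \sum_(k < nK) u 0 k <= 1].

Definition dual_objective (R : realType) (nI : nat)
    (lambda v : 'rV[R]_nI) : R :=
  \sum_(i < nI) lambda 0 i * v 0 i.

Definition dual_optimal (R : realType) (nI nK : nat)
    (J : {set 'I_nI * 'I_nK}) (lambda : 'rV[R]_nI) (mu : 'M[R]_(nI, nK))
    (v : 'rV[R]_nI) (u : 'rV[R]_nK) : Prop :=
  dual_feasible J mu v u /\
  forall v' u', dual_feasible J mu v' u' ->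
    dual_objective lambda v' <= dual_objective lambda v.

Definition heavy_traffic_solution (R : realType) (nI nK : nat)
    (J : {set 'I_nI * 'I_nK}) (lambda : 'rV[R]_nI) (mu : 'M[R]_(nI, nK))
    (x : 'M[R]_(nI, nK)) : Prop :=
  primal_optimal J lambda mu x 1 /\
  forall k, \sum_(i < nI | (i, k) \in J) x i k = 1.

Definition relaxed_heavy_traffic (R : realType) (nI nK : nat)
    (J : {set 'I_nI * 'I_nK}) (lambda : 'rV[R]_nI) (mu : 'M[R]_(nI, nK)) :
    Prop :=
  exists x, heavy_traffic_solution J lambda mu x.

Definition basic_activity (R : realType) (nI nK : nat)
    (J : {set 'I_nI * 'I_nK}) (x : 'M[R]_(nI, nK))
    (i : 'I_nI) (k : 'I_nK) : Prop :=
  (i, k) \in J /\ 0 < x i k.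

Definition communicate_directly (R : realType) (nI nK : nat)
    (J : {set 'I_nI * 'I_nK}) (lambda : 'rV[R]_nI) (mu : 'M[R]_(nI, nK))
    (k k' : 'I_nK) : Prop :=
  exists (x : 'M[R]_(nI, nK)) (i : 'I_nI),
    [/\ heavy_traffic_solution J lambda mu x,
        basic_activity J x i k & basic_activity J x i k'].

(* The chain is s 0, ..., s w; its values beyond w are irrelevant. *)
Definition communicate (R : realType) (nI nK : nat)
    (J : {set 'I_nI * 'I_nK}) (lambda : 'rV[R]_nI) (mu : 'M[R]_(nI, nK))
    (k k' : 'I_nK) : Prop :=
  exists (w : nat) (s : nat -> 'I_nK),
    [/\ s 0%N = k, s w = k' &
        forall a, (a < w)%N ->
          communicate_directly J lambda mu (s a) (s a.+1)].

Definition relaxed_complete_resource_pooling (R : realType) (nI nK : nat)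
    (J : {set 'I_nI * 'I_nK}) (lambda : 'rV[R]_nI) (mu : 'M[R]_(nI, nK)) :
    Prop :=
  (exists x, heavy_traffic_solution J lambda mu x) /\
  forall k k', communicate J lambda mu k k'.

(* Main.v *)
Require Import Defs.
From mathcomp Require Import boolp ring lra.
Import Order.TTheory GRing.Theory Num.Theory.
Local Open Scope ring_scope.

(** Since mu v <= u on J, an optimal primal x gives
    lambda.v = \sum_J x mu v <= \sum_J x u = \sum_k u_k <= 1.  By Farkas' lemma
    the dual has value 1, so for every dual optimum both inequalities are
    equalities: \sum_k u_k = 1, and mu_ik v_i = u_k at every basic activity
    (i, k) of every optimal x.  Hence the ratio u_k / u_k' is the same for all
    dual optima when k and k' communicate directly, and by pooling for all k
    and k'; together with \sum_k u_k = 1 this determines u, and then v. *)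

(** * Farkas' lemma for finitely many linear forms *)

Lemma scalar_add_scaled {R : realType} {V : lmodType R} {f : V -> R} a x y :
  scalar f -> f (x + a *: y) = f x + a * f y.
Proof. by move=> lin; rewrite addrC lin addrC. Qed.

Lemma scalar0 {R : realType} {V : lmodType R} {f : V -> R} : scalar f -> f 0 = 0.
Proof. by move=> lin; have := lin (-1) 0 0; rewrite scaler0 addr0; lra. Qed.

(* Bartl's proof by induction on the list of forms: if the head form f t is
   needed, some x1 satisfies the other inequalities but has c x1 > 0 and,
   after scaling, f t x1 = 1; the induction hypothesis is applied to the forms
   composed with the projection x - f t x *: x1 onto the kernel of f t. *)
Lemma farkas {R : realType} {V : lmodType R} {T : eqType} {s : seq T}
    {f : T -> V -> R} {c : V -> R} :
  uniq s -> (forall t, scalar (f t)) -> scalar c ->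
  (forall x, (forall t, t \in s -> f t x <= 0) -> c x <= 0) ->
  exists2 y : T -> R, (forall t, 0 <= y t) &
    forall x, c x = \sum_(t <- s) y t * f t x.
Proof.
elim: s f c => [|t s IHs] f c.
  (* With no constraints [c] is nonpositive at both [x] and [-x], hence zero. *)
  move=> _ _ linc c_le0; exists (fun=> 0) => // x; rewrite big_nil.
  have := scalar_add_scaled (-1) 0 x linc.
  have cx_le0 : c x <= 0 by apply: c_le0.
  have : c (0 + (-1) *: x) <= 0 by apply: c_le0.
  rewrite (scalar0 linc); lra.
rewrite cons_uniq => /andP[tNs uniq_s] linf linc c_le0.
have replace_at_t (y : T -> R) (a : R) g :
  \sum_(t' <- t :: s) (if t' == t then a else y t') * g t' =
  a * g t + \sum_(t' <- s) y t' * g t'.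
  rewrite big_cons eqxx; congr (_ + _); apply: eq_big_seq => t' t's.
  by case: eqP => // t'E; rewrite -t'E t's in tNs.
have [sub|/existsNP[x0 /not_implyP[s_x0 /negP]]] :=
  pselect (forall x, (forall t', t' \in s -> f t' x <= 0) -> c x <= 0).
  have [y y_ge0 cE] := IHs f c uniq_s linf linc sub.
  exists (fun t' => if t' == t then 0 else y t') => [t'|x]; first by case: ifP.
  by rewrite (replace_at_t y 0 (f^~ x)) mul0r add0r.
rewrite -ltNge => cx0_gt0.
have ftx0_gt0 : 0 < f t x0.
  rewrite ltNge; apply/negP => ftx0_le0.
  suff : c x0 <= 0 by rewrite leNgt cx0_gt0.
  by apply: c_le0 => t'; rewrite inE => /predU1P[->//|/s_x0].
(* The leading [0 +] gives [x1] the shape that [scalar_add_scaled] expects. *)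
pose x1 := 0 + (f t x0)^-1 *: x0.
have x1E g : scalar g -> g x1 = (f t x0)^-1 * g x0.
  by move=> ling; rewrite scalar_add_scaled // scalar0 // add0r.
have ftx1 : f t x1 = 1 by rewrite x1E // mulVf // gt_eqF.
have cx1_ge0 : 0 <= c x1 by rewrite x1E // mulr_ge0 // ?invr_ge0 ltW.
have s_x1 t' : t' \in s -> f t' x1 <= 0.
  by move=> /s_x0 ?; rewrite x1E // mulr_ge0_le0 // invr_ge0 ltW.
pose proj g x := g x - f t x * g x1.
have projE g x : scalar g -> proj g x = g (x + (- f t x) *: x1).
  by move=> ling; rewrite scalar_add_scaled // mulNr.
have lin_proj g : scalar g -> scalar (proj g).
  by move=> ling a x y; rewrite /proj ling linf /=; ring.
have proj_le0 x : (forall t', t' \in s -> proj (f t') x <= 0) ->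
    proj c x <= 0.
  move=> projs; rewrite projE //; apply: c_le0 => t'.
  rewrite inE => /predU1P[->|/projs]; last by rewrite projE.
  by rewrite -projE // /proj ftx1 mulr1 subrr.
have [y y_ge0 projcE] := IHs (fun t' => proj (f t')) (proj c) uniq_s
  (fun t' => lin_proj _ (linf t')) (lin_proj _ linc) proj_le0.
(* This is the coefficient of [f t x] once the projections in [projcE] are expanded. *)
pose a := c x1 - \sum_(t' <- s) y t' * f t' x1.
have a_ge0 : 0 <= a.
  rewrite subr_ge0 (le_trans _ cx1_ge0) // big_seq sumr_le0 // => t' t's.
  by rewrite mulr_ge0_le0 // s_x1.
exists (fun t' => if t' == t then a else y t') => [t'|x]; first by case: ifP.
rewrite (replace_at_t y a (f^~ x)).
have := projcE x; rewrite /proj.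
under eq_bigr => t' _ do rewrite mulrBr mulrCA.
rewrite sumrB -mulr_sumr /a => /eqP; rewrite subr_eq => /eqP ->; ring.
Qed.

Lemma sum_single {R : realType} {I : finType} {P : pred I} {F : I -> R} i0 :
  P i0 -> (forall i, i != i0 -> F i = 0) -> \sum_(i | P i) F i = F i0.
Proof.
move=> Pi0 F0; rewrite (bigD1 i0) //= big1 ?addr0 // => i /andP[_].
exact: F0.
Qed.

(** * Linear programming duality for the static allocation problem *)

Section StaticAllocation.
Context {R : realType} {nI nK : nat} {J : {set 'I_nI * 'I_nK}}.
Context {lambda : 'rV[R]_nI} {mu : 'M[R]_(nI, nK)}.

(** The duality gap in exact form: expanding [lambda] by the demand equations turns the left side
    into the sum of [u 0 k * x i k] over [J], and every server has load exactly 1. *)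
Lemma weak_duality {x} v (u : 'rV[R]_nK) :
  heavy_traffic_solution J lambda mu x ->
  dual_objective lambda v +
    \sum_(i < nI) \sum_(k < nK | (i, k) \in J) (u 0 k - mu i k * v 0 i) * x i k
  = \sum_(k < nK) u 0 k.
Proof.
move=> [[[_ _ lambdaE _] _] x1].
rewrite /dual_objective -big_split /=.
transitivity (\sum_(i < nI) \sum_(k < nK | (i, k) \in J) u 0 k * x i k).
  apply: eq_bigr => i _; rewrite -lambdaE mulr_suml -big_split /=.
  by apply: eq_bigr => k _; ring.
rewrite (exchange_big_dep xpredT) //=; apply: eq_bigr => k _.
by rewrite -mulr_sumr x1 mulr1.
Qed.

(** Strong duality: optimality of the value 1 says that [tau - rho] is nonpositive on the
    homogenized feasible cone, and the Farkas multipliers of this inequality form a dual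
    solution. *)
Lemma dual_value_one x :
  primal_optimal J lambda mu x 1 ->
  exists v u, dual_feasible J mu v u /\ dual_objective lambda v = 1.
Proof.
move=> [_ rho_ge1].
pose V : lmodType R := ('M[R]_(nI, nK) * R^o * R^o)%type.
pose T : finType := ((('I_nI * 'I_nK) + unit) + ('I_nI * bool + 'I_nK))%type.
pose served (x : 'M[R]_(nI, nK)) i :=
  \sum_(k < nK | (i, k) \in J) mu i k * x i k.
pose load (x : 'M[R]_(nI, nK)) k := \sum_(i < nI | (i, k) \in J) x i k.
have lin_served a x1 x2 i :
    served (a *: x1 + x2) i = a * served x1 i + served x2 i.
  rewrite /served mulr_sumr -big_split; apply: eq_bigr => k _ /=.
  by rewrite !mxE; ring.
have lin_load a x1 x2 k : load (a *: x1 + x2) k = a * load x1 k + load x2 k.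
  rewrite /load mulr_sumr -big_split; apply: eq_bigr => i _ /=.
  by rewrite !mxE.
(* The LP homogenized by a variable tau: z = (x, rho, tau) satisfies
   served x = tau * lambda and load x <= rho. *)
pose f (t : T) (z : V) : R := match t with
  | inl (inl (i, k)) => - z.1.1 i k
  | inl (inr _) => - z.1.2
  | inr (inl (i, b)) => (-1) ^+ b * (z.2 * lambda 0 i - served z.1.1 i)
  | inr (inr k) => load z.1.1 k - z.1.2
  end.
pose c (z : V) : R := z.2 - z.1.2.
have linf t : scalar (f t).
  move=> a [[x1 r1] t1] [[x2 r2] t2]; case: t => [[[i k]|?]|[[i b]|k]] /=;
  rewrite ?mxE ?lin_served ?lin_load /GRing.scale /=; ring.
have linc : scalar c.
  move=> a [[x1 r1] t1] [[x2 r2] t2].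
  by rewrite /c /= /GRing.scale /=; ring.
have c_le0 z : (forall t, t \in index_enum T -> f t z <= 0) -> c z <= 0.
  move=> f_le0; have {}f_le0 t := f_le0 t (mem_index_enum t).
  case: z f_le0 => [[y rho] tau] f_le0; rewrite /c /=.
  have y_ge0 i k : 0 <= y i k by have := f_le0 (inl (inl (i, k))); rewrite /f /=; lra.
  have rho_ge0 : 0 <= rho by have := f_le0 (inl (inr tt)); rewrite /f /=; lra.
  have loadE k : load y k <= rho by have := f_le0 (inr (inr k)); rewrite /f /=; lra.
  have servedE i : served y i = tau * lambda 0 i.
    have := f_le0 (inr (inl (i, true))); have := f_le0 (inr (inl (i, false))).
    by rewrite /f /= expr0 expr1; lra.
  (* If [tau <= 0], then [rho >= 0] suffices; otherwise dividing by [tau] gives a feasible point of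
     the LP with value [rho / tau], which is at least 1. *)
  have [|tau_gt0] := leP tau 0; first lra.
  suff : 1 <= tau^-1 * rho by rewrite mulrC ler_pdivlMr // mul1r; lra.
  apply: (rho_ge1 (tau^-1 *: y)).
  have tauV_ge0 : 0 <= tau^-1 by rewrite invr_ge0 ltW.
  split=> [i k _||i|k].
  - by rewrite mxE mulr_ge0.
  - by rewrite mulr_ge0.
  - have := lin_served tau^-1 y 0 i; rewrite addr0 -/(served _ _) => ->.
    rewrite servedE mulKf ?gt_eqF // /served big1 ?addr0 // => k _.
    by rewrite mxE mulr0.
  - have := lin_load tau^-1 y 0 k; rewrite addr0 -/(load _ _) => ->.
    rewrite {2}/load big1 ?addr0 ?ler_wpM2l // => i _.
    by rewrite mxE.
have [y y_ge0 cE] := farkas (index_enum_uniq T) linf linc c_le0.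
(* Each demand equation entered as two opposite inequalities, so its dual variable is a difference
   of multipliers and has free sign. *)
pose v : 'rV[R]_nI := \row_i (y (inr (inl (i, false))) - y (inr (inl (i, true)))).
pose u : 'rV[R]_nK := \row_k y (inr (inr k)).
have {}cE (x1 : 'M[R]_(nI, nK)) (rho tau : R) : tau - rho =
    - (\sum_p y (inl (inl p)) * x1 p.1 p.2) - y (inl (inr tt)) * rho
    + (\sum_i v 0 i * (tau * lambda 0 i - served x1 i)
       + \sum_k u 0 k * (load x1 k - rho)).
  have := cE (x1, rho, tau); rewrite /c /= => ->.
  rewrite !big_sumType /=; congr (_ + _ + (_ + _)).
  - by rewrite -sumrN; apply: eq_bigr => -[i k] _ /=; rewrite mulrN.
  - by rewrite (big_pred1 tt) => [|[]]; rewrite ?mulrN.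
  - transitivity (\sum_i \sum_b y (inr (inl (i, b))) *
        ((-1) ^+ b * (tau * lambda 0 i - served x1 i))).
      by rewrite pair_bigA; apply: eq_bigr => -[i b].
    by apply: eq_bigr => i _; rewrite big_bool /= mxE expr0 expr1; ring.
  - by apply: eq_bigr => k _; rewrite mxE.
have served0 i : served 0 i = 0.
  by rewrite /served big1 // => k _; rewrite mxE mulr0.
have load0 k : load 0 k = 0 by rewrite /load big1 // => i _; rewrite mxE.
have sum0 : \sum_p y (inl (inl p)) * (0 : 'M[R]_(nI, nK)) p.1 p.2 = 0.
  by rewrite big1 // => p _; rewrite mxE mulr0.
(* The identity [cE] is tested at a matrix unit for [mu i k * v 0 i <= u 0 k], at [rho = 1] for the
   bound on the sum of [u], and at [tau = 1] for the objective. *)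
exists v, u; split; first split.
- by move=> k; rewrite mxE.
- move=> i k ikJ; have := cE (delta_mx i k) 0 0.
  have served_delta i' : served (delta_mx i k) i' = (i' == i)%:R * mu i k.
    rewrite /served; have [->|/negPf i'i] := eqVneq i' i.
      rewrite (sum_single k) // => [|k' /negPf k'k]; rewrite mxE ?k'k ?andbF ?mulr0 //.
      by rewrite !eqxx mulrC.
    by rewrite mul0r big1 // => k' _; rewrite mxE i'i mulr0.
  have load_delta k' : load (delta_mx i k) k' = (k' == k)%:R.
    rewrite /load; have [->|/negPf k'k] := eqVneq k' k.
      by rewrite (sum_single i) // => [|i' /negPf i'i]; rewrite mxE ?i'i ?eqxx.
    by rewrite big1 // => i' _; rewrite mxE k'k andbF.
  rewrite (sum_single (i, k)) // => [|[i' k']]; last first.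
    by rewrite xpair_eqE mxE => /negPf ->; rewrite mulr0.
  rewrite (sum_single i) // => [|i' /negPf i'i]; last first.
    by rewrite served_delta i'i !mul0r subrr mulr0.
  rewrite (sum_single k) // => [|k' /negPf k'k]; last first.
    by rewrite load_delta k'k subrr mulr0.
  rewrite served_delta load_delta mxE !eqxx /=.
  have := y_ge0 (inl (inl (i, k))); lra.
- have := cE 0 1 0; rewrite sum0.
  rewrite big1 => [|i _]; last by rewrite served0 mul0r subr0 mulr0.
  under eq_bigr => k _ do rewrite load0 sub0r mulrN1.
  rewrite sumrN; have := y_ge0 (inl (inr tt)); lra.
- have := cE 0 0 1; rewrite sum0.
  rewrite [X in _ + (_ + X)]big1 => [|k _]; last by rewrite load0 subr0 mulr0.
  under eq_bigr => i _ do rewrite served0 mul1r subr0 mulrC.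
  rewrite -/(dual_objective lambda v); lra.
Qed.

Lemma dual_optimal_value {x v u} :
  primal_optimal J lambda mu x 1 -> dual_optimal J lambda mu v u ->
  1 <= dual_objective lambda v.
Proof.
by move=> /dual_value_one[v' [u' [feas <-]]] [_ opt]; apply: opt feas.
Qed.

Lemma weak_duality_slack_ge0 {x v u} :
  heavy_traffic_solution J lambda mu x -> dual_feasible J mu v u ->
  forall i k, (i, k) \in J -> 0 <= (u 0 k - mu i k * v 0 i) * x i k.
Proof.
move=> [[[x_ge0 _ _ _] _] _] [_ muv_le _] i k ikJ.
by rewrite mulr_ge0 ?x_ge0 // subr_ge0 muv_le.
Qed.

Lemma dual_objective_le1 {x v u} :
  heavy_traffic_solution J lambda mu x -> dual_feasible J mu v u ->
  dual_objective lambda v <= 1.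
Proof.
move=> sol feas; have [_ _ sum_le1] := feas.
apply: le_trans sum_le1; rewrite -(weak_duality v u sol) lerDl.
do 2 (apply: sumr_ge0 => ? ?); exact: (weak_duality_slack_ge0 sol feas).
Qed.

Lemma dual_optimal_exists {x} :
  heavy_traffic_solution J lambda mu x ->
  exists v u, dual_optimal J lambda mu v u.
Proof.
move=> sol; have [v [u [feas obj1]]] := dual_value_one x (proj1 sol).
exists v, u; split=> // v' u' feas'.
by rewrite obj1 (dual_objective_le1 sol feas').
Qed.

(** The objective is at least 1 and the sum of [u] at most 1, which forces the gap in [weak_duality]
    to vanish; its terms are nonnegative, so each is zero. *)
Lemma complementary_slackness {x v u} :
  heavy_traffic_solution J lambda mu x -> dual_optimal J lambda mu v u ->
  \sum_(k < nK) u 0 k = 1 /\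
  (forall i k, basic_activity J x i k -> mu i k * v 0 i = u 0 k).
Proof.
move=> sol opt; have [feas _] := opt; have [_ _ sum_le1] := feas.
have obj_ge1 := dual_optimal_value (proj1 sol) opt.
have slack_ge0 := weak_duality_slack_ge0 sol feas.
have row_ge0 i :
    0 <= \sum_(k < nK | (i, k) \in J) (u 0 k - mu i k * v 0 i) * x i k.
  by apply: sumr_ge0 => k; apply: slack_ge0.
have dualE := weak_duality v u sol.
have gap0 : \sum_(i < nI) \sum_(k < nK | (i, k) \in J)
    (u 0 k - mu i k * v 0 i) * x i k = 0.
  apply/eqP; rewrite eq_le sumr_ge0 ?andbT //; lra.
split=> [|i k [ikJ x_gt0]]; first by apply/eqP; rewrite eq_le sum_le1 /=; lra.
have := @psumr_eq0P _ _ xpredT _ (fun i _ => row_ge0 i) gap0 i isT.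
move=> /(psumr_eq0P (slack_ge0 i))/(_ k ikJ)/eqP.
by rewrite mulf_eq0 (gt_eqF x_gt0) orbF subr_eq0 => /eqP.
Qed.

(** Otherwise the demand equation of class [i] would have left side zero. *)
Lemma basic_activity_of_class {x} i :
  0 < lambda 0 i -> (forall k, (i, k) \in J -> 0 < mu i k) ->
  heavy_traffic_solution J lambda mu x -> exists k, basic_activity J x i k.
Proof.
move=> lambda_gt0 mu_gt0 [[[x_ge0 _ lambdaE _] _] _].
apply: contrapT => /forallNP nobasic.
move: lambda_gt0; rewrite -lambdaE big1 ?ltxx // => k ikJ.
have [|] := ltP 0 (x i k); first by move=> ?; case: (nobasic k).
by move=> x_le0; apply/eqP; rewrite mulf_eq0 [x i k == 0]eq_le x_le0 x_ge0 ?orbT.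
Qed.

(** * Propagation of dual prices along communicating servers *)

Context (mu_gt0 : forall i k, (i, k) \in J -> 0 < mu i k).

(** By slackness both prices are positive multiples of [v 0 i] for the shared class [i]. *)
Lemma communicate_directly_gt0 {v u k k'} :
  dual_optimal J lambda mu v u -> communicate_directly J lambda mu k k' ->
  0 < u 0 k -> 0 < u 0 k'.
Proof.
move=> opt [x [i [sol b b']]]; have [_ slack] := complementary_slackness sol opt.
by rewrite -!(slack i) // !pmulr_rgt0 ?mu_gt0 ?(proj1 b) ?(proj1 b').
Qed.

Lemma communicate_gt0 {v u k k'} :
  dual_optimal J lambda mu v u -> communicate J lambda mu k k' ->
  0 < u 0 k -> 0 < u 0 k'.
Proof.
move=> opt [w [s [<- <- direct]]] us0.
elim: w direct => // w IHw direct.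
apply: (communicate_directly_gt0 opt (direct w _)) => //.
by apply: IHw => a /ltnW; apply: direct.
Qed.

Lemma communicate_ratio {v1 u1 v2 u2 k k'} :
  dual_optimal J lambda mu v1 u1 -> dual_optimal J lambda mu v2 u2 ->
  (forall l, 0 < u1 0 l) ->
  communicate J lambda mu k k' -> u1 0 k * u2 0 k' = u2 0 k * u1 0 k'.
Proof.
move=> opt1 opt2 u1_gt0 [w [s [<- <- direct]]].
elim: w direct => [_|w IHw direct]; first exact: mulrC.
have {}IHw : u1 0 (s 0%N) * u2 0 (s w) = u2 0 (s 0%N) * u1 0 (s w).
  by apply: IHw => a /ltnW; apply: direct.
have [x [i [sol b b']]] := direct w (ltnSn w).
have [_ slack1] := complementary_slackness sol opt1.
have [_ slack2] := complementary_slackness sol opt2.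
have step : u1 0 (s w) * u2 0 (s w.+1) = u2 0 (s w) * u1 0 (s w.+1).
  by rewrite -!(slack1 i) // -!(slack2 i) //; ring.
(* Multiplying by the price of the intermediate server lets [IHw] and [step] be chained; its
   positivity allows the cancellation. *)
apply: (mulfI (lt0r_neq0 (u1_gt0 (s w)))).
by rewrite mulrCA step mulrA IHw; ring.
Qed.

End StaticAllocation.

(** * Positivity and uniqueness of the dual optimum *)

Theorem lemma3p2 (R : realType) (nI nK : nat)
    (J : {set 'I_nI * 'I_nK}) (lambda : 'rV[R]_nI) (mu : 'M[R]_(nI, nK))
    (lambda_gt0 : forall i, 0 < lambda 0 i)
    (mu_gt0 : forall i k, (i, k) \in J -> 0 < mu i k)
    (HT : relaxed_heavy_traffic J lambda mu)
    (CRP : relaxed_complete_resource_pooling J lambda mu) :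
  (exists! vu : 'rV[R]_nI * 'rV[R]_nK, dual_optimal J lambda mu vu.1 vu.2) /\
  (forall (v : 'rV[R]_nI) (u : 'rV[R]_nK), dual_optimal J lambda mu v u ->
     (forall k, 0 < u 0 k) /\ (forall i, 0 < v 0 i)).
Proof.
have [x sol] := HT; have [_ pooled] := CRP.
have u_gt0 v u : dual_optimal J lambda mu v u -> forall k, 0 < u 0 k.
  move=> opt; have [[u_ge0 _ _] _] := opt.
  have [sum1 _] := complementary_slackness sol opt.
  have [k0 uk0] : exists k0, 0 < u 0 k0.
    apply: contrapT => /forallNP u_le0; move/eqP: sum1.
    rewrite big1 => [|k _]; first by rewrite eq_sym oner_eq0.
    by apply/eqP; rewrite eq_le u_ge0 andbT leNgt; apply/negP.
  by move=> k; apply: (communicate_gt0 mu_gt0 opt (pooled k0 k)).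
have basic i : exists k, basic_activity J x i k.
  by apply: (basic_activity_of_class i _ _ sol) => // k; apply: mu_gt0.
split; last first.
  move=> v u opt; split; first exact: u_gt0 opt.
  move=> i; have [k b] := basic i.
  have [_ slack] := complementary_slackness sol opt.
  by rewrite -(pmulr_rgt0 _ (mu_gt0 i k (proj1 b))) slack // (u_gt0 v).
have [v [u opt]] := dual_optimal_exists sol.
exists (v, u); split=> // -[v' u'] /= opt'.
have [sum1 slack] := complementary_slackness sol opt.
have [sum1' slack'] := complementary_slackness sol opt'.
have uE : u = u'.
  (* Multiply [u 0 k] by the sum of [u'] and [u' 0 k] by the sum of [u], both equal to 1; the
     products then agree term by term. *)
  apply/rowP => k; rewrite -[LHS]mulr1 -[RHS]mulr1 -{1}sum1' -sum1 !mulr_sumr.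
  apply: eq_bigr => l _.
  exact: communicate_ratio opt opt' (u_gt0 v u opt) (pooled k l).
(* A basic activity of class [i] recovers [v 0 i] from [u 0 k]. *)
congr (_, _) => //; apply/rowP => i; have [k b] := basic i.
apply: (mulfI (lt0r_neq0 (mu_gt0 i k (proj1 b)))).
by rewrite slack // slack' // uE.
Qed.
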